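(* Let $\ell_1(x)=x_1$, $\ell_2(x)=x_2$, $\ell_3(x)=-5x_1-3x_2+15$ (so $\{\ell_1,\ell_2,\ell_3\ge0\}$ is the moment polytope of $\mathbb P(1,3,5)$) and $$\ell_4^{\kappa_4}(x)=-x_1-x_2+\kappa_4,\quad \ell_5^{\kappa_5}(x)=-3x_1-2x_2+\kappa_5,\quad \ell_6^{\kappa_6}(x)=-2x_1-x_2+\kappa_6,\quad \ell_7^{\kappa_7}(x)=-x_1+\kappa_7 .$$ There is $\epsilon>0$ such that the following holds. Let $\kappa_4,\kappa_5,\kappa_6,\kappa_7$ satisfy $0<5-\kappa_4<\epsilon$, $0<10-\kappa_5<\epsilon$, $0<6-\kappa_6<\epsilon$, $0<3-\kappa_7<\epsilon$ and be such that the vertices of $$\overline\Delta(\kappa)=\{x\in\mathbb R^2:\ \ell_1,\ell_2,\ell_3\ge0,\ \ell_j^{\kappa_j}\ge0\text{ for }j=4,5,6,7\}$$ are $(0,0)$, $(0,\kappa_4)$, $(\kappa_5-2\kappa_4,\,3\kappa_4-\kappa_5)$, $(3(10-\kappa_5),\,5(\kappa_5-9))$, $(3(\kappa_6-5),\,5(6-\kappa_6))$, $(\kappa_7,\,\kappa_6-2\kappa_7)$, $(\kappa_7,0)$. If $x\in\mathrm{Int}\,\overline\Delta(\kappa)$ does not lie on one of the lines $$\{\ell_1=\ell_4^{\kappa_4}\},\quad\{\ell_4^{\kappa_4}=\ell_5^{\kappa_5}\},\quad\{\ell_5^{\kappa_5}=\ell_3\}$$ and is not the point $n_1=(\kappa_7/2,\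 \kappa_6/2-\kappa_7/2)$, then the Lagrangian fiber $L_x$ is displaceable by probes or extended probes.
   Context: Fibers are those of the moment map $\Phi$ of the symplectic toric manifold $(M,\omega,\Phi)$ with $\Phi(M)=\overline\Delta(\kappa)$ (unique up to equivariant symplectomorphism); $L_x=\Phi^{-1}(x)$. A set $X$ is displaceable if some compactly supported Hamiltonian diffeomorphism $\phi$ satisfies $\phi(X)\cap\overline X=\emptyset$. Probes and extended probes in a rational polygon $\Delta$ (facets $F\subset\{\langle\eta_F,x\rangle+\kappa_F=0\}$, $\eta_F$ primitive interior conormal). If $x-y=tv$ with $v$ primitive integral, $d_{\mathrm{aff}}(x,y)=|t|$; $d_{\mathrm{aff}}(x,F)=|\langle\eta_F,x\rangle+\kappa_F|$. A probe $P$ is a directed segment in $\Delta$ from $b_P$ in the interior of a facet $F_P$ to $b_P+\ell(P)v_P$, with $v_P\in\mathbb Z^2$ primitive and $\langle\eta_{F_P},v_P\rangle=1$; $\ell(P)$ is its length. For $u\in\mathrm{Int}\,\Delta$, $L_u$ is displaceable by probes or extended probes if one of the following holds (each implies that $L_u$ is displaceable): (a) $u\in P$ for a probe $P$ and $d_{\mathrm{aff}}(u,F_P)<\frac12\ell(P)$. (b) There are a symmetric probe $Q$ (its endpoint lies in the interior of a facet $F_Q'$ with $\langle\eta_{F_Q'},v_Q\rangle=-1$), with affine reflection $A_Q(x)=x+\langle\eta_{F_Q'}-\eta_{F_Q},x\rangle v_Q+(\kappa_{F_Q'}-\kappa_{F_Q})v_Q$ and linear part $\widehat A_Q$, a probe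 $P$ ending at $x_{PQ}$ in the interior of $Q$, and a segment $P'\subset\Delta$ from $x_{PQ}'=A_Q(x_{PQ})$ to $x'_{PQ}+\ell(P')\widehat A_Q(v_P)$, such that either $u\in\mathrm{Int}\,P$ and $d_{\mathrm{aff}}(u,F_P)<\frac12(\ell(P)+\ell(P'))$, or $u\in\mathrm{Int}\,P'$ and $\ell(P)+d_{\mathrm{aff}}(x'_{PQ},u)<\frac12(\ell(P)+\ell(P'))$ (symmetric extended probe). (c) There are probes $P,Q$ with $P$ ending at $x_{PQ}\in Q$ and $v_P$ parallel to $F_Q$, points $x_{\mathcal F},x_{\mathcal F}'\in Q$ and $\ell(\mathcal F)\ge0$ such that the convex hull of $x_{\mathcal F},x'_{\mathcal F},x_{\mathcal F}+\ell(\mathcal F)v_P,x'_{\mathcal F}+\ell(\mathcal F)v_P$ lies in $\Delta$, $u\in\mathrm{Int}\,P$, $d_{\mathrm{aff}}(u,F_P)<\frac12(\ell(P)+\ell(\mathcal F))$ and $d_{\mathrm{aff}}(x_{PQ},F_Q)<d_{\mathrm{aff}}(x_{\mathcal F},x'_{\mathcal F})$ (parallel extended probe with flag). *)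

(* Defs.v *)
(* MathComp / MathComp-Analysis *)
From HB Require Import structures.
From mathcomp Require Import all_boot all_order all_algebra.
From mathcomp Require Import all_classical all_reals all_analysis.
Set Implicit Arguments.
Unset Strict Implicit.
Unset Printing Implicit Defensive.
Import Order.TTheory GRing.Theory Num.Theory.
Import numFieldNormedType.Exports.
Local Open Scope classical_set_scope.
Local Open Scope ring_scope.

Section Probes.
Variable R : realType.

Definition toR2 (v : int * int) : R * R := (v.1%:~R, v.2%:~R).

Definition primitive (v : int * int) : bool := coprimez v.1 v.2.

Definition pairing (eta : int * int) (x : R * R) : R :=
  eta.1%:~R * x.1 + eta.2%:~R * x.2.

(* A facet is recorded as [(eta_F, kappa_F)], with [eta_F] the primitive
   interior conormal, and a rational polygon as the list of its facets; as a
   set of points the facet is [polygon D] cut with [ell F x = 0]. *)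
Definition facet : Type := ((int * int) * R)%type.

Definition ell (F : facet) (x : R * R) : R := pairing F.1 x + F.2.

Definition polygon (D : seq facet) : set (R * R) :=
  [set x | forall F, F \in D -> 0 <= ell F x].

(* The interior of the facet relative to its supporting line, so a constraint
   that cuts out only a vertex (or nothing) contributes no points. *)
Definition facet_interior (D : seq facet) (F : facet) : set (R * R) :=
  [set x | ell F x = 0 /\
           \forall y \near within [set z | ell F z = 0] (nbhs x), polygon D y].

Definition vertex (A : set (R * R)) (p : R * R) : Prop :=
  A p /\ forall y z (t : R), A y -> A z -> 0 < t < 1 ->
    p = (1 - t) *: y + t *: z -> y = p /\ z = p.

Definition convex_hull (A : set (R * R)) : set (R * R) :=
  smallest [set C : set (R * R) | convex_set (C : set (convex_lmodType (R * R)%type))] A.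

(* [is_daff x y d] : the affine distance between [x] and [y] is defined, that
   is [x - y] is a multiple of an integral vector, and equals [d]. *)
Definition is_daff (x y : R * R) (d : R) : Prop :=
  exists v t, [/\ primitive v, x - y = t *: toR2 v & d = `|t|].

Definition daff_facet (x : R * R) (F : facet) : R := `|ell F x|.

Definition segment (b w : R * R) (l : R) : set (R * R) :=
  [set b + s *: w | s in [set s : R | 0 <= s <= l]].

Definition open_segment (b w : R * R) (l : R) : set (R * R) :=
  [set b + s *: w | s in [set s : R | 0 < s < l]].

Record directed_segment := DirectedSegment {
  base : R * R;          (* b_P *)
  base_facet : facet;    (* F_P *)
  dir : int * int;       (* v_P *)
  len : R                (* l(P) *)
}.

Definition support (P : directed_segment) : set (R * R) :=
  segment (base P) (toR2 (dir P)) (len P).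

Definition support_interior (P : directed_segment) : set (R * R) :=
  open_segment (base P) (toR2 (dir P)) (len P).

Definition endpoint (P : directed_segment) : R * R :=
  base P + len P *: toR2 (dir P).

Definition probe (D : seq facet) (P : directed_segment) : Prop :=
  [/\ base_facet P \in D,
      facet_interior D (base_facet P) (base P),
      primitive (dir P),
      pairing (base_facet P).1 (toR2 (dir P)) = 1
    & 0 < len P /\ support P `<=` polygon D].

(* [F'] is the facet F_Q' in which the symmetric probe [Q] ends. *)
Definition symmetric_probe (D : seq facet) (Q : directed_segment) (F' : facet) :
    Prop :=
  [/\ probe D Q, F' \in D, facet_interior D F' (endpoint Q)
    & pairing F'.1 (toR2 (dir Q)) = - 1].

Definition reflection_linear (Q : directed_segment) (F' : facet) (w : R * R) :
    R * R :=
  w + pairing (F'.1 - (base_facet Q).1) w *: toR2 (dir Q).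

Definition reflection (Q : directed_segment) (F' : facet) (x : R * R) : R * R :=
  x + pairing (F'.1 - (base_facet Q).1) x *: toR2 (dir Q)
    + (F'.2 - (base_facet Q).2) *: toR2 (dir Q).

Definition displaceable_by_probe (D : seq facet) (u : R * R) : Prop :=
  exists P, [/\ probe D P, support P u
              & daff_facet u (base_facet P) < 2^-1 * len P].

Definition displaceable_by_symmetric_extended_probe (D : seq facet)
    (u : R * R) : Prop :=
  exists (P Q : directed_segment) (F' : facet) (l' : R),
    let x' := reflection Q F' (endpoint P) in
    let w' := reflection_linear Q F' (toR2 (dir P)) in
    [/\ probe D P, symmetric_probe D Q F', support_interior Q (endpoint P),
        0 <= l' /\ segment x' w' l' `<=` polygon D
      & (support_interior P u /\
           daff_facet u (base_facet P) < 2^-1 * (len P + l')) \/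
        (open_segment x' w' l' u /\
           exists d, is_daff x' u d /\ len P + d < 2^-1 * (len P + l'))].

Definition displaceable_by_parallel_extended_probe (D : seq facet)
    (u : R * R) : Prop :=
  exists (P Q : directed_segment) (xF xF' : R * R) (lF : R),
    let w := lF *: toR2 (dir P) in
    [/\ [/\ probe D P, probe D Q, support Q (endpoint P)
          & pairing (base_facet Q).1 (toR2 (dir P)) = 0],
        [/\ support Q xF, support Q xF', 0 <= lF
          & convex_hull [set xF; xF'; xF + w; xF' + w] `<=` polygon D],
        support_interior P u,
        daff_facet u (base_facet P) < 2^-1 * (len P + lF)
      & exists d, is_daff xF xF' d /\
                  daff_facet (endpoint P) (base_facet Q) < d].

(* [D] encodes the moment polygon and [u] one of its interior points; the three
   ways of displacing the fiber over [u] are conditions on [D] and [u] only. *)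
Definition fiber_displaceable_by_probes_or_extended_probes (D : seq facet)
    (u : R * R) : Prop :=
  [\/ displaceable_by_probe D u,
      displaceable_by_symmetric_extended_probe D u
    | displaceable_by_parallel_extended_probe D u].

Definition F1 : facet := ((1, 0), 0).
Definition F2 : facet := ((0, 1), 0).
Definition F3 : facet := ((- 5, - 3), 15).
Definition F4 (k4 : R) : facet := ((- 1, - 1), k4).
Definition F5 (k5 : R) : facet := ((- 3, - 2), k5).
Definition F6 (k6 : R) : facet := ((- 2, - 1), k6).
Definition F7 (k7 : R) : facet := ((- 1, 0), k7).

Definition facets (k4 k5 k6 k7 : R) : seq facet :=
  [:: F1; F2; F3; F4 k4; F5 k5; F6 k6; F7 k7].

Lemma facets_primitive (k4 k5 k6 k7 : R) (F : facet) :
  F \in facets k4 k5 k6 k7 -> primitive F.1.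
Proof. by move=> FD; do ?[case/predU1P: FD => [-> //|FD]]. Qed.

End Probes.

Arguments F1 {R}.
Arguments F2 {R}.
Arguments F3 {R}.

(* Main.v *)
Require Import Defs.
From HB Require Import structures.
From mathcomp Require Import all_boot all_order all_algebra.
From mathcomp Require Import all_classical all_reals all_analysis.
From mathcomp Require Import ring lra.
Set Implicit Arguments.
Unset Strict Implicit.
Unset Printing Implicit Defensive.
Import Order.TTheory GRing.Theory Num.Theory.
Import numFieldNormedType.Exports.
Local Open Scope classical_set_scope.
Local Open Scope ring_scope.

(** The polygon is the triangle with vertices [(0, 0)], [(0, 5)], [(3, 0)] with
    its corners at [(0, 5)] and [(3, 0)] cut off by tiny facets.  Everything
    rests on one family of symmetric probes: the direction [(1, -1)] joins the
    facet [F1] to the tiny facet [F6], so the lines [x1 + x2 = sg] with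
    [k6 - k7 < sg < 15 - 2 k6] are symmetric probes [Q] crossing the whole
    polygon.  The affine reflection in [Q] turns the direction [(1, -2)] into
    [(0, -1)] and [(0, 1)] into [(-1, 2)].

    Above the lowest of these lines ([k6 - k7 < x1 + x2]) a probe through [x]
    in direction [(1, -2)] is bent at [Q] into a vertical segment reaching down
    to [F2], which is longer than the probe; hence every point of the probe is
    displaced ([displaceable_by_steep_bent_probe]).  All of [F1], [F4], [F5],
    [F3] pair to 1 with [(1, -2)], so the probe starts on the one of these
    facets that minimises [ell] at [x], and it starts at a vertex exactly when
    the minimum is attained twice; the minimum changes hands across the three
    excluded parallel lines.

    Below, for [x1] not small, two bent probes complement each other across
    the line [x1 + x2 = k6 / 2]: one goes vertically up from [F2] and is bent
    into direction [(-1, 2)] ([displaceable_below_midline]); the other comes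
    down from [F1] in direction [(1, -2)] and passes through [x] vertically
    after the bend ([displaceable_above_midline]).  Both broken paths have
    affine length [k6 - 2 x1], and [x] is at distance [x2] from the start of the
    first and from the end of the second; so the first displaces
    [x2 < k6 / 2 - x1] and the second [x2 > k6 / 2 - x1].  On the line
    [x1 + x2 = k6 / 2] itself, the probes in directions [(1, -1)] from [F1] and
    [(-1, 1)] from [F7] have length [k7] and displace everything but their
    common midpoint [n1].  The remaining points, with [x1 <= 6 / 5], lie in the
    first half of a probe [(1, -1)] from [F1] or [(0, 1)] from [F2].

    The prescribed vertices enter through the nondegeneracy of the four short
    edges: a vertex lies in the polygon, and consecutive vertices differ. *)

(** * Affine functions, facets and probes of a polygon *)

Section Polygons.
Context (R : realType).
Implicit Types (x y b w : R * R) (F G : facet R) (D : seq (facet R)).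

Lemma point_on_line b (v : int * int) (s : R) :
  b + s *: toR2 R v = (b.1 + s * v.1%:~R, b.2 + s * v.2%:~R).
Proof. by []. Qed.

Lemma ell_translate F x w (s : R) :
  ell F (x + s *: w) = ell F x + s * pairing F.1 w.
Proof.
rewrite /ell /pairing -[(x + s *: w).1]/(x.1 + s * w.1).
by rewrite -[(x + s *: w).2]/(x.2 + s * w.2); ring.
Qed.

Lemma pairingB (eta eta' : int * int) x :
  pairing (eta - eta') x = pairing eta x - pairing eta' x.
Proof.
rewrite /pairing -[(eta - eta').1]/(eta.1 - eta'.1).
by rewrite -[(eta - eta').2]/(eta.2 - eta'.2) !intrB; ring.
Qed.

(** The reflection exchanges the affine distances to the two end facets of the
    symmetric probe; this form is the one to compute with. *)
Lemma reflection_ell (Q : directed_segment R) F x :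
  reflection Q F x = x + (ell F x - ell (base_facet Q) x) *: toR2 R (dir Q).
Proof.
rewrite /reflection pairingB -addrA -scalerDl /ell.
by congr (_ + _ *: _); ring.
Qed.

Lemma ell_continuous F : continuous (ell F).
Proof.
move=> x; rewrite /ell /pairing.
apply: (@cvgD _ R); last exact: cvg_cst.
apply: (@cvgD _ R); apply: (@cvgM R); try exact: cvg_cst.
- exact: cvg_fst.
- exact: cvg_snd.
Qed.

(** A point of a facet at which no other constraint is active keeps all the
    other constraints on a neighbourhood, by continuity. *)
Lemma facet_interior_of_pos D F x : ell F x = 0 ->
  (forall G, G \in D -> G = F \/ 0 < ell G x) -> facet_interior D F x.
Proof.
move=> Fx Dx; split => //.
suff: \forall y \near nbhs x, forall G, G \in D -> G = F \/ 0 <= ell G y.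
  move=> nx; near=> y => G GD.
  have [-> | //] : G = F \/ 0 <= ell G y.
    move: G GD; near: y; exact: cvg_within nx.
  suff -> : ell F y = 0 by [].
  by near: y; exact: withinT.
elim: D Dx => [|H D IH] Dx; first by near=> y.
have nD : \forall y \near nbhs x, forall G, G \in D -> G = F \/ 0 <= ell G y.
  by apply: IH => G GD; apply: Dx; rewrite inE GD orbT.
case: (Dx H (mem_head _ _)) => [HF|Hx].
  near=> y => G; rewrite inE => /predU1P[->|GD]; first by left.
  by move: G GD; near: y.
near=> y => G; rewrite inE => /predU1P[->|GD].
  right; apply: ltW; near: y.
  exact: cvgr_gt (@ell_continuous H x) _ Hx.
by move: G GD; near: y.
Unshelve. all: by end_near. Qed.

(** From an interior point one can still move a little against the conormal,
    which strictly decreases [ell F]. *)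
Lemma interior_polygon_pos D F x : F \in D -> primitive F.1 ->
  (polygon D)° x -> 0 < ell F x.
Proof.
move=> FD Fprim xD; pose n := toR2 R F.1.
have n0 : 0 < pairing F.1 n.
  rewrite /pairing /n /= -!expr2 lt0r addr_ge0 ?sqr_ge0// andbT.
  rewrite paddr_eq0 ?sqr_ge0// !sqrf_eq0 !intr_eq0.
  by apply: contraL Fprim => /andP[/eqP F10 /eqP F20]; rewrite /primitive F10 F20.
have c : x + s *: - n @[s --> (0 : R)^'+] --> x.
  rewrite -[X in _ --> X]addr0 -[X in _ + X](scale0r (- n)).
  apply: cvgD; first exact: cvg_cst.
  by apply: cvgZ; [exact: cvg_within|exact: cvg_cst].
have [s [s0 xsD]] : exists s : R, 0 < s /\ polygon D (x + s *: - n).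
  apply: (@filter_ex _ (0 : R)^'+); near=> s; split.
    by near: s; exact: nbhs_right_gt.
  by near: s; exact: c xD.
have := xsD F FD; rewrite ell_translate.
have -> : pairing F.1 (- n) = - pairing F.1 n by rewrite /pairing /=; ring.
have := mulr_gt0 s0 n0; lra.
Unshelve. all: by end_near. Qed.

Lemma segment_sub_polygon D b w (l : R) :
  polygon D b -> polygon D (b + l *: w) -> segment b w l `<=` polygon D.
Proof.
move=> bD blD _ [s /andP[s0 sl] <-] F FD.
have := blD F FD; have := bD F FD; rewrite !ell_translate => Fb Fbl.
by have [p0|p0] := leP 0 (pairing F.1 w); nra.
Qed.

Lemma probe_intro D F b (v : int * int) (l : R) :
  F \in D -> ell F b = 0 -> (forall G, G \in D -> G = F \/ 0 < ell G b) ->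
  primitive v -> pairing F.1 (toR2 R v) = 1 -> 0 < l ->
  polygon D (b + l *: toR2 R v) -> probe D (DirectedSegment b F v l).
Proof.
move=> FD Fb Gb vprim Fv l0 blD; split=> //; first exact: facet_interior_of_pos.
split=> //; apply: segment_sub_polygon => // G GD.
by have [->|/ltW //] := Gb _ GD; rewrite Fb.
Qed.

Lemma displaceable_before_midpoint D F b (v : int * int) (l s : R) x :
  probe D (DirectedSegment b F v l) -> x = b + s *: toR2 R v ->
  0 <= s -> s < 2^-1 * l -> fiber_displaceable_by_probes_or_extended_probes D x.
Proof.
move=> Pp -> s0 sl; apply: Or31; exists (DirectedSegment b F v l).
case: (Pp) => /= _ [Fb _] _ Fv [l0 _]; split=> //.
  by exists s => //; apply/andP; split => //=; lra.
by rewrite /daff_facet /= ell_translate Fb Fv mulr1 add0r ger0_norm.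
Qed.

Lemma ellE (k4 k5 k6 k7 : R) x :
  (ell F1 x = x.1) * (ell F2 x = x.2) * (ell F3 x = 15 - 5 * x.1 - 3 * x.2) *
  (ell (F4 k4) x = k4 - x.1 - x.2) * (ell (F5 k5) x = k5 - 3 * x.1 - 2 * x.2) *
  (ell (F6 k6) x = k6 - 2 * x.1 - x.2) * (ell (F7 k7) x = k7 - x.1).
Proof. by do !split; rewrite /ell /pairing /=; ring. Qed.

Lemma all_facets (k4 k5 k6 k7 : R) (P : facet R -> Prop) :
  P F1 -> P F2 -> P F3 -> P (F4 k4) -> P (F5 k5) -> P (F6 k6) -> P (F7 k7) ->
  forall F, F \in facets k4 k5 k6 k7 -> P F.
Proof. by move=> p1 p2 p3 p4 p5 p6 p7 F; do ?[case/predU1P=> [->//|]]. Qed.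

Lemma mem_facets (k4 k5 k6 k7 : R) (D := facets k4 k5 k6 k7) :
  [/\ F1 \in D, F2 \in D, F3 \in D, F4 k4 \in D &
  [/\ F5 k5 \in D, F6 k6 \in D & F7 k7 \in D]].
Proof. by rewrite !inE !eqxx !orbT. Qed.

End Polygons.

(** The four last inequalities say that the edges on [F4], [F5], [F6], [F7]
    are not reduced to points. *)
Record near_triangle (R : realType) (k4 k5 k6 k7 : R) : Prop := NearTriangle {
  k4_bounds : 0 < 5 - k4 < 1 / 10;
  k5_bounds : 0 < 10 - k5 < 1 / 10;
  k6_bounds : 0 < 6 - k6 < 1 / 10;
  k7_bounds : 0 < 3 - k7 < 1 / 10;
  edge4_nondegenerate : 2 * k4 < k5;
  edge5_nondegenerate : 2 * k5 < 15 + k4;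
  edge6_nondegenerate : 3 * k6 < 15 + k7;
  edge7_nondegenerate : 2 * k7 < k6
}.

Section NearTriangle.
Context (R : realType) (k4 k5 k6 k7 : R) (kP : near_triangle k4 k5 k6 k7).
Implicit Types (x y b : R * R) (F G : facet R).
Local Notation D := (facets k4 k5 k6 k7).

Lemma mem_polygon y : 0 <= y.1 -> 0 <= y.2 -> 5 * y.1 + 3 * y.2 <= 15 ->
  y.1 + y.2 <= k4 -> 3 * y.1 + 2 * y.2 <= k5 -> 2 * y.1 + y.2 <= k6 ->
  y.1 <= k7 -> polygon D y.
Proof. by move=> *; apply: all_facets; rewrite (ellE k4 k5 k6 k7); lra. Qed.

Ltac sizes := case: kP => /andP[? ?] /andP[_ ?] /andP[? ?] /andP[? ?] _ _ ? ?.
Ltac by_pairing := rewrite /pairing /=; lra.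
Ltac at_point := rewrite ?point_on_line ?(ellE k4 k5 k6 k7) /=.
Ltac facet_positivity :=
  apply: all_facets; at_point; try (right; lra); by left.
Ltac in_polygon := apply: mem_polygon; rewrite ?point_on_line /=; lra.

Lemma polygon_interior_pos x : (polygon D)° x -> forall F, F \in D -> 0 < ell F x.
Proof.
by move=> xD F FD; apply: (interior_polygon_pos FD) xD; exact: facets_primitive FD.
Qed.

Lemma interior_coords x : (polygon D)° x ->
  [/\ 0 < x.1, 0 < x.2, 5 * x.1 + 3 * x.2 < 15, x.1 + x.2 < k4 &
  [/\ 3 * x.1 + 2 * x.2 < k5, 2 * x.1 + x.2 < k6 & x.1 < k7]].
Proof.
have [F1D F2D F3D F4D [F5D F6D F7D]] := mem_facets k4 k5 k6 k7.
move=> /polygon_interior_pos xD; move: (xD _ F1D) (xD _ F2D) (xD _ F3D).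
move: (xD _ F4D) (xD _ F5D) (xD _ F6D) (xD _ F7D).
by rewrite !(ellE k4 k5 k6 k7) => *; do !split; lra.
Qed.

(** * The symmetric probes from [F1] to [F6] *)

Definition crossing (sg : R) : directed_segment R :=
  DirectedSegment (0, sg) F1 (1, -1) (k6 - sg).

(** The bounds on [sg] place the endpoint strictly between the two vertices of
    [F6], whose coordinate sums are [k6 - k7] and [15 - 2 * k6]. *)
Lemma crossing_symmetric (sg : R) : k6 - k7 < sg -> sg < 15 - 2 * k6 ->
  symmetric_probe D (crossing sg) (F6 k6).
Proof.
have [F1D F2D _ _ [_ F6D _]] := mem_facets k4 k5 k6 k7.
sizes; move=> sg_gt sg_lt; split=> //.
- apply: probe_intro => //.
  + by at_point.
  + facet_positivity.
  + by_pairing.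
  + lra.
  + in_polygon.
- apply: facet_interior_of_pos; rewrite /endpoint.
    by at_point; lra.
  facet_positivity.
- by_pairing.
Qed.

Lemma crossing_level (m : R) : k6 - k7 < m ->
  exists sg, [/\ k6 - k7 < sg, sg < 15 - 2 * k6 & sg < m].
Proof.
sizes; move=> m_gt; have [] := @midf_lt _ (k6 - k7) (Num.min (15 - 2 * k6) m).
  by rewrite lt_min m_gt andbT; lra.
by rewrite lt_min => ? /andP[? ?]; eexists; split; eassumption.
Qed.

(** The reflections in all the probes [crossing sg] coincide: they depend only
    on the two end facets and on the direction. *)
Definition mirror y : R * R := (k6 - 2 * y.1 - y.2, 3 * y.1 + 2 * y.2 - k6).

Definition mirror_dir (v : int * int) : int * int :=
  (- 2 * v.1 - v.2, 3 * v.1 + 2 * v.2).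

Lemma reflection_crossing sg y : reflection (crossing sg) (F6 k6) y = mirror y.
Proof.
rewrite reflection_ell point_on_line !(ellE k4 k5 k6 k7) /= /mirror.
by congr pair; ring.
Qed.

Lemma reflection_linear_crossing sg (v : int * int) :
  reflection_linear (crossing sg) (F6 k6) (toR2 R v) = toR2 R (mirror_dir v).
Proof.
rewrite /reflection_linear pairingB point_on_line /pairing /toR2 /=.
rewrite /mirror_dir /= !(intrD, intrB, intrM).
by congr pair; ring.
Qed.

(** A probe that meets the line [x1 + x2 = sg] at [y] continues from
    [mirror y], and the first half of the resulting broken path is
    displaceable, whether [x] comes before or after the bend. *)
Lemma displaceable_by_bent_probe F b (v : int * int) (p l sg : R) x :
  let y := b + p *: toR2 R v in
  k6 - k7 < sg -> sg < 15 - 2 * k6 ->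
  probe D (DirectedSegment b F v p) ->
  y.1 + y.2 = sg -> 0 < y.1 < k6 - sg ->
  0 <= l -> primitive (mirror_dir v) ->
  polygon D (mirror y + l *: toR2 R (mirror_dir v)) ->
  (exists2 s, x = b + s *: toR2 R v & 0 < s < p /\ s < 2^-1 * (p + l)) \/
  (exists2 s, x = mirror y + s *: toR2 R (mirror_dir v) &
    0 < s < l /\ p + s < 2^-1 * (p + l)) ->
  fiber_displaceable_by_probes_or_extended_probes D x.
Proof.
move=> y sg_gt sg_lt Pp ysg /andP[y1_gt y1_lt] l0 v'prim y'lD xs.
have Qp := crossing_symmetric sg_gt sg_lt.
have yP : endpoint (DirectedSegment b F v p) = y by [].
move: y yP ysg y1_gt y1_lt y'lD xs => [y1 y2] yP /= ysg y1_gt y1_lt y'lD xs.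
apply: Or32; exists (DirectedSegment b F v p), (crossing sg), (F6 k6), l => /=.
rewrite yP reflection_crossing reflection_linear_crossing.
split=> //.
- exists y1; first by apply/andP.
  by rewrite point_on_line /=; congr pair; lra.
- split=> //; apply: segment_sub_polygon => //.
  (* the reflection preserves the symmetric probe, so [mirror y] lies on it *)
  case: Qp => -[_ _ _ _ [_ QD]] _ _ _; apply: QD; exists (k6 - sg - y1).
    by apply/andP; split=> /=; lra.
  by rewrite point_on_line /mirror /=; congr pair; lra.
- case: xs => -[s -> [s_in s_lt]]; [left|right].
    split; first by exists s.
    case: Pp => /= _ [Fb _] _ Fv _; have [s0 _] := andP s_in.
    by rewrite /daff_facet /= ell_translate Fb Fv mulr1 add0r gtr0_norm.
  split; first by exists s.
  exists s; split=> //; exists (mirror_dir v), (- s); split=> //.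
    by rewrite scaleNr opprD addrA subrr add0r.
  by rewrite normrN gtr0_norm //; case/andP: s_in.
Qed.

(** * Bent probes *)

(** Going back from [x] along [(1, -2)] lowers [ell] at unit speed on the
    facets that pair to 1 with this direction, so the first one to be reached
    is the strict minimiser [F], away from the others.  After the bend at
    level [sg < x1 + x2] the path runs down to [F2] over a length exceeding
    that of the probe, because [2 sg > k6]. *)
Lemma displaceable_by_steep_bent_probe F x :
  (polygon D)° x -> k6 - k7 < x.1 + x.2 ->
  F \in D -> pairing F.1 (toR2 R (1, -2)) = 1 ->
  (forall G, G \in D -> pairing G.1 (toR2 R (1, -2)) = 1 ->
    G = F \/ ell F x < ell G x) ->
  fiber_displaceable_by_probes_or_extended_probes D x.
Proof.
move=> xI Sx FD Fv Fmin; have [? ? ? ? [? ? ?]] := interior_coords xI.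
have [s Fx] : exists s, ell F x = s by eexists.
have s_gt0 : 0 < s by rewrite -Fx; exact: polygon_interior_pos xI F FD.
rewrite Fx in Fmin; sizes.
have [F1D _ F3D F4D [F5D _ _]] := mem_facets k4 k5 k6 k7.
have F1min : s <= x.1.
  have F1v : pairing (@F1 R).1 (toR2 R (1, -2)) = 1 by by_pairing.
  have := Fmin F1 F1D F1v; rewrite -Fx -(ellE k4 k5 k6 k7 x).1.1.1.1.1.1.
  by case=> [->|/ltW].
have [sg [? ? ?]] := crossing_level Sx.
pose b := x + (- s) *: toR2 R (1, -2).
have bE : b = (x.1 - s, x.2 + 2 * s).
  by rewrite /b point_on_line /=; congr pair; ring.
have b_pos G : G \in D -> pairing G.1 (toR2 R (1, -2)) = 1 ->
    G = F \/ 0 < ell G b.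
  move=> GD Gv; have [|lt_sG] := Fmin G GD Gv; first by left.
  by right; rewrite ell_translate Gv; lra.
(* [l] is the height of the point [mirror y] at which the path is bent *)
apply: (@displaceable_by_bent_probe F b (1, -2) (x.1 + x.2 + s - sg)
  (2 * x.1 + x.2 + sg - k6) sg) => //.
- apply: probe_intro => //.
  + by rewrite /b ell_translate Fv Fx; lra.
  + by apply: all_facets; try (by apply: b_pos => //; by_pairing);
      right; rewrite bE; at_point; lra.
  + lra.
  + by rewrite bE; in_polygon.
- by rewrite bE point_on_line /=; lra.
- by rewrite bE point_on_line /=; apply/andP; split; lra.
- lra.
- by rewrite bE /mirror; in_polygon.
- left; exists s; last by split; [apply/andP; split|]; lra.
  by rewrite bE point_on_line /= [LHS]surjective_pairing; congr pair; lra.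
Qed.

(** The probe starts on [F1] at height [k6 - x1], chosen so that its mirror
    image is the vertical line through [x]. *)
Lemma displaceable_above_midline x :
  (polygon D)° x -> x.1 + x.2 <= k6 - k7 -> 6 / 5 < x.1 ->
  k6 / 2 < x.1 + x.2 -> fiber_displaceable_by_probes_or_extended_probes D x.
Proof.
move=> xI ? ? ?; have [? ? _ _ [_ ? ?]] := interior_coords xI.
sizes; have [F1D _ _ _ _] := mem_facets k4 k5 k6 k7.
have /crossing_level[sg [? ? ?]] : k6 - k7 < k6 - x.1 by lra.
apply: (@displaceable_by_bent_probe F1 (0, k6 - x.1) (1, -2)
  (k6 - x.1 - sg) (sg - x.1) sg) => //.
- apply: probe_intro => //.
  + by at_point.
  + facet_positivity.
  + by_pairing.
  + lra.
  + in_polygon.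
- by rewrite point_on_line /=; lra.
- by rewrite point_on_line /=; apply/andP; split; lra.
- lra.
- rewrite /mirror; in_polygon.
- right; exists (sg - x.1 - x.2); last by split; [apply/andP; split|]; lra.
  by rewrite !point_on_line /= [LHS]surjective_pairing; congr pair; lra.
Qed.

(** The vertical line through [x] meets the level [sg] after [sg - x1], and the
    reflected half reaches [F1] after [k6 - sg - x1]: the midpoint of the whole
    path is at height [k6 / 2 - x1], for every [sg]. *)
Lemma displaceable_below_midline x :
  (polygon D)° x -> 6 / 5 < x.1 ->
  x.1 + x.2 < k6 / 2 -> fiber_displaceable_by_probes_or_extended_probes D x.
Proof.
move=> xI ? ?; have [? ? _ _ [_ ? ?]] := interior_coords xI.
sizes; have [_ F2D _ _ _] := mem_facets k4 k5 k6 k7.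
have /crossing_level[sg [? ? ?]] : k6 - k7 < k6 - x.1 by lra.
apply: (@displaceable_by_bent_probe F2 (x.1, 0) (0, 1)
  (sg - x.1) (k6 - sg - x.1) sg) => //.
- apply: probe_intro => //.
  + by at_point.
  + facet_positivity.
  + by_pairing.
  + lra.
  + in_polygon.
- by rewrite point_on_line /=; lra.
- by rewrite point_on_line /=; apply/andP; split; lra.
- lra.
- rewrite /mirror; in_polygon.
- left; exists x.2; last by split; [apply/andP; split|]; lra.
  by rewrite !point_on_line /= [LHS]surjective_pairing; congr pair; lra.
Qed.

(** * Straight probes *)

(** The probe in direction [(1, -1)] through [x] ends on [F2] or on [F7],
    according to which of [x1 + x2] and [k7] is smaller. *)
Lemma displaceable_from_F1 x :
  (polygon D)° x -> x.1 < x.2 -> x.1 + x.2 <= k6 - k7 -> x.1 < k7 / 2 ->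
  fiber_displaceable_by_probes_or_extended_probes D x.
Proof.
move=> xI ? ? ?; have [? ? _ _ [_ ? ?]] := interior_coords xI.
sizes; have [F1D _ _ _ _] := mem_facets k4 k5 k6 k7.
pose l := Num.min k7 (x.1 + x.2).
have [? ? ?] : [/\ l <= k7, l <= x.1 + x.2 & 2 * x.1 < l].
  rewrite /l ge_min lexx ge_min lexx orbT lt_min.
  by split=> //; apply/andP; split; lra.
apply: (@displaceable_before_midpoint _ _ F1 (0, x.1 + x.2) (1, -1) l x.1).
- apply: probe_intro => //.
  + by at_point.
  + facet_positivity.
  + by_pairing.
  + lra.
  + in_polygon.
- by rewrite !point_on_line /= [LHS]surjective_pairing; congr pair; lra.
- lra.
- lra.
Qed.

(** The vertical chord at abscissa [x1 <= 6 / 5] is longer than [5 / 2], whereas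
    [2 x2 <= 2 x1 < 5 / 2]. *)
Lemma displaceable_from_F2 x :
  (polygon D)° x -> x.2 <= x.1 -> x.1 <= 6 / 5 ->
  fiber_displaceable_by_probes_or_extended_probes D x.
Proof.
move=> xI ? ?; have [? ? _ _ [_ ? ?]] := interior_coords xI.
sizes; have [_ F2D _ _ _] := mem_facets k4 k5 k6 k7.
apply: (@displaceable_before_midpoint _ _ F2 (x.1, 0) (0, 1) (5 / 2) x.2).
- apply: probe_intro => //.
  + by at_point.
  + facet_positivity.
  + by_pairing.
  + in_polygon.
- by rewrite !point_on_line /= [LHS]surjective_pairing; congr pair; lra.
- lra.
- lra.
Qed.

(** The midline [x1 + x2 = k6 / 2] meets the interior of [F7], because
    [k6 / 2] lies strictly between [k7] and [k6 - k7]. *)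
Lemma displaceable_from_F7 x :
  (polygon D)° x -> x.1 + x.2 = k6 / 2 -> k7 / 2 < x.1 ->
  fiber_displaceable_by_probes_or_extended_probes D x.
Proof.
move=> xI ? ?; have [? ? _ _ [_ ? ?]] := interior_coords xI.
sizes; have [_ _ _ _ [_ _ F7D]] := mem_facets k4 k5 k6 k7.
apply: (@displaceable_before_midpoint _ _ (F7 k7) (k7, k6 / 2 - k7) (-1, 1)
  k7 (k7 - x.1)).
- apply: probe_intro => //.
  + by at_point; lra.
  + facet_positivity.
  + by_pairing.
  + lra.
  + in_polygon.
- by rewrite !point_on_line /= [LHS]surjective_pairing; congr pair; lra.
- lra.
- lra.
Qed.

(** * The two halves of the polygon *)

(** The minimiser among [F1], [F4], [F5], [F3] is read off from the position of
    [2 x1 + x2] with respect to [k4 < k5 - k4 < 15 - k5], the levels of the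
    three excluded lines. *)
Lemma displaceable_far x :
  (polygon D)° x -> k6 - k7 < x.1 + x.2 ->
  ell F1 x <> ell (F4 k4) x -> ell (F4 k4) x <> ell (F5 k5) x ->
  ell (F5 k5) x <> ell F3 x ->
  fiber_displaceable_by_probes_or_extended_probes D x.
Proof.
move=> xI Sx; rewrite !(ellE k4 k5 k6 k7) => ne14 ne45 ne53.
have [F1D _ F3D F4D [F5D _ _]] := mem_facets k4 k5 k6 k7.
case: kP => _ _ _ _ ? ? _ _.
have [h4|h4|h4] := ltgtP (2 * x.1 + x.2) k4; last by case: ne14; lra.
  apply: (displaceable_by_steep_bent_probe xI Sx F1D); first by by_pairing.
  by apply: all_facets; rewrite /pairing /= => ?; at_point;
    first [by left | lra | right; lra].
have [h5|h5|h5] := ltgtP (2 * x.1 + x.2) (k5 - k4); last by case: ne45; lra.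
  apply: (displaceable_by_steep_bent_probe xI Sx F4D); first by by_pairing.
  by apply: all_facets; rewrite /pairing /= => ?; at_point;
    first [by left | lra | right; lra].
have [h3|h3|h3] := ltgtP (2 * x.1 + x.2) (15 - k5); last by case: ne53; lra.
  apply: (displaceable_by_steep_bent_probe xI Sx F5D); first by by_pairing.
  by apply: all_facets; rewrite /pairing /= => ?; at_point;
    first [by left | lra | right; lra].
apply: (displaceable_by_steep_bent_probe xI Sx F3D); first by by_pairing.
by apply: all_facets; rewrite /pairing /= => ?; at_point;
  first [by left | lra | right; lra].
Qed.

(** The threshold [6 / 5] is less than [k7 / 2], so the probes from [F1] pass
    it, and exceeds 1 by enough for both bent probes: the steep one then starts
    below the vertex [(0, k4)], and the one turned into direction [(-1, 2)]
    runs up to [F1] without leaving the polygon across [F3], [F4] or [F5]. *)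
Lemma displaceable_near x :
  (polygon D)° x -> x.1 + x.2 <= k6 - k7 ->
  x <> (k7 / 2, k6 / 2 - k7 / 2) ->
  fiber_displaceable_by_probes_or_extended_probes D x.
Proof.
move=> xI Sx ne1; sizes.
have [x1_le|x1_gt] := leP x.1 (6 / 5).
  have [x21|x12] := leP x.2 x.1; first exact: displaceable_from_F2.
  by apply: displaceable_from_F1 => //; lra.
have [S_lt|S_gt|S_eq] := ltgtP (x.1 + x.2) (k6 / 2).
- exact: displaceable_below_midline.
- exact: displaceable_above_midline.
have [x1_lt|x1_gt'|x1_eq] := ltgtP x.1 (k7 / 2).
- by apply: displaceable_from_F1 => //; lra.
- exact: displaceable_from_F7.
- by case: ne1; rewrite [LHS]surjective_pairing; congr pair; lra.
Qed.

End NearTriangle.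

(** Each inequality is weak because a vertex lies in the polygon, and strict
    because equality would merge it with the next vertex. *)
Lemma near_triangle_of_vertices (R : realType) (k4 k5 k6 k7 : R) :
  0 < 5 - k4 < 1 / 10 -> 0 < 10 - k5 < 1 / 10 ->
  0 < 6 - k6 < 1 / 10 -> 0 < 3 - k7 < 1 / 10 ->
  let V : seq (R * R) :=
    [:: (0, 0); (0, k4); (k5 - 2 * k4, 3 * k4 - k5);
        (3 * (10 - k5), 5 * (k5 - 9)); (3 * (k6 - 5), 5 * (6 - k6));
        (k7, k6 - 2 * k7); (k7, 0)] in
  uniq V -> {in V, forall p, polygon (facets k4 k5 k6 k7) p} ->
  near_triangle k4 k5 k6 k7.
Proof.
move=> k4P k5P k6P k7P V Vuniq VD.
have [F1D F2D F3D F4D [F5D F6D F7D]] := mem_facets k4 k5 k6 k7.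
have nthD i F : (i < 7)%N -> F \in facets k4 k5 k6 k7 -> 0 <= ell F (nth (0, 0) V i).
  by move=> i7; apply: VD; exact: mem_nth.
have next_neq i : (i < 6)%N -> nth (0, 0) V i <> nth (0, 0) V i.+1.
  move=> i6 /eqP; rewrite nth_uniq //; last exact: ltnW.
  by rewrite eqn_leq ltnn andbF.
have strict (u v : R) i : (i < 6)%N -> u <= v ->
    (u = v -> nth (0, 0) V i = nth (0, 0) V i.+1) -> u < v.
  by move=> i6 uv uvV; rewrite lt_neqAle uv andbT; apply/eqP => /uvV/(next_neq i i6).
split=> //.
- apply: (strict _ _ 1) => //= [|?]; last by congr pair; lra.
  by have := nthD 2 F1 isT F1D; rewrite (ellE k4 k5 k6 k7) /=; lra.
- apply: (strict _ _ 2) => //= [|?]; last by congr pair; lra.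
  by have := nthD 3 (F4 k4) isT F4D; rewrite (ellE k4 k5 k6 k7) /=; lra.
- apply: (strict _ _ 4) => //= [|?]; last by congr pair; lra.
  by have := nthD 4 (F7 k7) isT F7D; rewrite (ellE k4 k5 k6 k7) /=; lra.
- apply: (strict _ _ 5) => //= [|?]; last by congr pair; lra.
  by have := nthD 5 F2 isT F2D; rewrite (ellE k4 k5 k6 k7) /=; lra.
Qed.

Theorem proposition4p6p2 (R : realType) :
  exists eps : R, 0 < eps /\
    forall k4 k5 k6 k7 : R,
      0 < 5 - k4 < eps -> 0 < 10 - k5 < eps ->
      0 < 6 - k6 < eps -> 0 < 3 - k7 < eps ->
      let D := facets k4 k5 k6 k7 in
      let V : seq (R * R) :=
        [:: (0, 0); (0, k4); (k5 - 2 * k4, 3 * k4 - k5);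
            (3 * (10 - k5), 5 * (k5 - 9)); (3 * (k6 - 5), 5 * (6 - k6));
            (k7, k6 - 2 * k7); (k7, 0)] in
      uniq V ->
      (forall p : R * R, vertex (polygon D) p <-> p \in V) ->
      forall x : R * R,
        (polygon D)° x ->
        ell F1 x <> ell (F4 k4) x ->
        ell (F4 k4) x <> ell (F5 k5) x ->
        ell (F5 k5) x <> ell F3 x ->
        x <> (k7 / 2, k6 / 2 - k7 / 2) ->
        fiber_displaceable_by_probes_or_extended_probes D x.
Proof.
exists (1 / 10); split; first lra.
move=> k4 k5 k6 k7 k4P k5P k6P k7P D V Vuniq VP x xI ne14 ne45 ne53 ne1.
have kP : near_triangle k4 k5 k6 k7.
  by apply: (near_triangle_of_vertices k4P k5P k6P k7P Vuniq) => p /VP[].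
have [Sx|Sx] := leP (x.1 + x.2) (k6 - k7); first exact: displaceable_near.
exact: displaceable_far.
Qed.
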